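(* Let $A^\star\in\mathbb{R}^{n\times n}$, $B^\star\in\mathbb{R}^{n\times m}$, $C^\star\in\mathbb{R}^{p\times n}$ with $(A^\star,C^\star)$ observable with observability index $\ell^\star$ and $p\ell^\star>n$. Let $A_a\in\mathbb{R}^{(p\ell^\star-n)\times(p\ell^\star-n)}$, $B_a\in\mathbb{R}^{(p\ell^\star-n)\times m}$, $C_a\in\mathbb{R}^{p\times(p\ell^\star-n)}$ be chosen matrices. Let data $\{u^{\mathrm m}(k),y^{\mathrm m}_{\mathrm{aug}}(k)\}_{k=0}^T$ be generated as in the context, let $\Psi_0^{\mathrm{aug}},\Theta^{\mathrm{aug}}_{22},\mathscr{A}_{\mathrm{aug}},\mathscr{B}_{\mathrm{aug}},\mathscr{C}_{\mathrm{aug}},\mathbf{F}_{\ell^\star},\mathbf{L}_{\ell^\star},\mathbf{B}_{\ell^\star}$ be as in the context, assume $\Delta^{\mathrm{aug}}_{10}{\Delta^{\mathrm{aug}}_{10}}^\top\preceq\Theta^{\mathrm{aug}}$ and $\Psi_0^{\mathrm{aug}}{\Psi_0^{\mathrm{aug}}}^\top\succ\Theta_{22}^{\mathrm{aug}}$. Suppose there exist $\mathbf{Y}$ and $P=P^\top\succ0$ such that $$\begin{bmatrix}-P-\mathbf{L}_{\ell^\star}\mathscr{C}_{\mathrm{aug}}\mathbf{L}_{\ell^\star}^\top & \mathbf{F}_{\ell^\star}P+\mathbf{B}_{\ell^\star}\mathbf{Y} & \mathbf{L}_{\ell^\star}\mathscr{B}_{\mathrm{aug}}\\ P\mathbf{F}_{\ell^\star}^\top+\mathbf{Y}^\top\mathbf{B}_{\ell^\star}^\top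 & -P & -P\\ \mathscr{B}_{\mathrm{aug}}^\top\mathbf{L}_{\ell^\star}^\top & -P & -\mathscr{A}_{\mathrm{aug}}\end{bmatrix}\prec0,$$ and let $\mathbf{K}=\mathbf{Y}P^{-1}$. Then $(x,x_a,\chi)=0$ is globally asymptotically stable for the feedback interconnection of the plant $x^+=A^\star x+B^\star u$, $y=C^\star x$ with the controller $$\begin{bmatrix}x_a^+\\\chi^+\end{bmatrix}=\begin{bmatrix}A_a & B_a\mathbf{K}\\ \mathbf{L}_{\ell^\star}C_a & \mathbf{F}_{\ell^\star}+\mathbf{B}_{\ell^\star}\mathbf{K}\end{bmatrix}\begin{bmatrix}x_a\\\chi\end{bmatrix}+\begin{bmatrix}0\\\mathbf{L}_{\ell^\star}\end{bmatrix}y,\qquad u=\mathbf{K}\chi.$$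
   Context: Notation: $(v_1,\dots,v_r)$ denotes a stacked column vector. Let $\ell=\ell^\star$. $\mathbf{F}_\ell=\mathrm{blockdiag}(S_p,S_m)$ where $S_q\in\mathbb{R}^{q\ell\times q\ell}$ has blocks $I_q$ in block positions $(i,i+1)$, $i=1,\dots,\ell-1$, and zeros elsewhere; $\mathbf{L}_\ell\in\mathbb{R}^{(p\ell+m\ell)\times p}$ has $I_p$ in rows $p\ell-p+1,\dots,p\ell$ and zeros elsewhere; $\mathbf{B}_\ell\in\mathbb{R}^{(p\ell+m\ell)\times m}$ has $I_m$ in its last $m$ rows, zeros elsewhere. Data generation (augmented experiment): for $k=0,\dots,T$, with unknown noises $d^u,d^y$ and applied signal $u^{\mathrm m}$, the plant evolves as $x(k+1)=A^\star x(k)+B^\star(u^{\mathrm m}(k)-d^u(k))$, an artificial state evolves as $x_a^{\mathrm m}(k+1)=A_ax_a^{\mathrm m}(k)+B_au^{\mathrm m}(k)$, and the measured output is $y^{\mathrm m}_{\mathrm{aug}}(k)=C^\star x(k)+d^y(k)+C_ax^{\mathrm m}_a(k)$. Define $d^{y_a}(k)=\sum_{j=0}^{k-1}C_aA_a^{k-j-1}B_ad^u(j)$ and $d^{y_{\mathrm{aug}}}=d^y+d^{y_a}$. Matrices with columns indexed by $j=0,\dots,T-\ell$: column $j$ of $\Psi_1^{\mathrm{aug}}$ is $(y^{\mathrm m}_{\mathrm{aug}}(j+1),\dots,y^{\mathrm m}_{\mathrm{aug}}(j+\ell),u^{\mathrm m}(j+1),\dots,u^{\mathrm m}(j+\ell))$;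 column $j$ of $\Psi_0^{\mathrm{aug}}$ is $(y^{\mathrm m}_{\mathrm{aug}}(j),\dots,y^{\mathrm m}_{\mathrm{aug}}(j+\ell-1),u^{\mathrm m}(j),\dots,u^{\mathrm m}(j+\ell-1))$; column $j$ of $\Delta^{\mathrm{aug}}_{10}$ is $(d^{y_{\mathrm{aug}}}(j+\ell),d^{y_{\mathrm{aug}}}(j),\dots,d^{y_{\mathrm{aug}}}(j+\ell-1),d^u(j),\dots,d^u(j+\ell-1))$. $\Theta^{\mathrm{aug}}=(\Theta^{\mathrm{aug}})^\top\succeq0$ of size $p+p\ell+m\ell$ is given and partitioned as $\begin{bmatrix}\Theta^{\mathrm{aug}}_{11}&\Theta^{\mathrm{aug}}_{12}\\ (\Theta^{\mathrm{aug}}_{12})^\top&\Theta^{\mathrm{aug}}_{22}\end{bmatrix}$ with $\Theta^{\mathrm{aug}}_{11}\in\mathbb{R}^{p\times p}$. Define $\mathscr{A}_{\mathrm{aug}}=\Psi_0^{\mathrm{aug}}{\Psi_0^{\mathrm{aug}}}^\top-\Theta^{\mathrm{aug}}_{22}$, $\mathscr{B}_{\mathrm{aug}}=-\mathbf{L}_\ell^\top\Psi_1^{\mathrm{aug}}{\Psi_0^{\mathrm{aug}}}^\top+\Theta^{\mathrm{aug}}_{12}$, $\mathscr{C}_{\mathrm{aug}}=\mathbf{L}_\ell^\top\Psi_1^{\mathrm{aug}}{\Psi_1^{\mathrm{aug}}}^\top\mathbf{L}_\ell-\Theta^{\mathrm{aug}}_{11}$. *)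

(* Defs.v *)
From HB Require Import structures.
From mathcomp Require Import all_boot all_order all_algebra.
From mathcomp Require Import reals.
Set Implicit Arguments. Unset Strict Implicit. Unset Printing Implicit Defensive.
Import Order.TTheory GRing.Theory Num.Theory.
Local Open Scope ring_scope.

Definition obsmx {R : fieldType} {n p : nat} (A : 'M[R]_n) (C : 'M[R]_(p, n))
  (k : nat) : 'M[R]_((\sum_(i < k) p)%N, n) :=
  \mxcol_(i < k) (C *m A ^+ i).

Definition observable {R : fieldType} {n p : nat} (A : 'M[R]_n) (C : 'M[R]_(p, n)) :=
  \rank (obsmx A C n) = n.

Definition obs_index {R : fieldType} {n p : nat} (A : 'M[R]_n) (C : 'M[R]_(p, n))
  (l : nat) :=
  \rank (obsmx A C l) = n /\ forall k, (k < l)%N -> (\rank (obsmx A C k) < n)%N.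

Lemma blk_mod_lt q l (i : 'I_(q * l)) : (i %% q < q)%N.
Proof.
case: q i => [|q] i; last by rewrite ltn_mod.
by case: i => i; rewrite mul0n.
Qed.

Definition blk_row q l (i : 'I_(q * l)) : 'I_q := Ordinal (blk_mod_lt i).

Definition stack {R : Type} {q : nat} (l : nat) (f : nat -> 'cV[R]_q) (s : nat)
  : 'cV[R]_(q * l) :=
  \col_(i < q * l) f (s + (i %/ q))%N (blk_row i) ord0.

(** S_q : blocks I_q at block positions (i, i+1) *)
Definition shiftmx {R : pzRingType} (q l : nat) : 'M[R]_(q * l) :=
  \matrix_(r, c) (((((r %/ q).+1 == c %/ q) && (r %% q == c %% q))%N)%:R).

Definition Fmx {R : pzRingType} (p m l : nat) : 'M[R]_(p * l + m * l) :=
  block_mx (shiftmx p l) 0 0 (shiftmx m l).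

Definition Lmx {R : pzRingType} (p m l : nat) : 'M[R]_(p * l + m * l, p) :=
  col_mx (\matrix_(r < p * l, c < p) ((nat_of_ord r == p * (l - 1) + c)%N)%:R) 0.

Definition Bmx {R : pzRingType} (p m l : nat) : 'M[R]_(p * l + m * l, m) :=
  col_mx 0 (\matrix_(r < m * l, c < m) ((nat_of_ord r == m * (l - 1) + c)%N)%:R).

Definition colsmx {R : Type} {r : nat} (N : nat) (g : nat -> 'cV[R]_r) : 'M[R]_(r, N) :=
  \matrix_(i, j) g (nat_of_ord j) i ord0.

Definition Psi1 {R : Type} {p m : nat} (l T : nat) (y : nat -> 'cV[R]_p)
  (u : nat -> 'cV[R]_m) : 'M[R]_(p * l + m * l, T.+1 - l) :=
  colsmx (T.+1 - l) (fun j => col_mx (stack l y j.+1) (stack l u j.+1)).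

Definition Psi0 {R : Type} {p m : nat} (l T : nat) (y : nat -> 'cV[R]_p)
  (u : nat -> 'cV[R]_m) : 'M[R]_(p * l + m * l, T.+1 - l) :=
  colsmx (T.+1 - l) (fun j => col_mx (stack l y j) (stack l u j)).

Definition Delta10 {R : Type} {p m : nat} (l T : nat) (dy : nat -> 'cV[R]_p)
  (du : nat -> 'cV[R]_m) : 'M[R]_(p + (p * l + m * l), T.+1 - l) :=
  colsmx (T.+1 - l)
    (fun j => col_mx (dy (j + l)%N) (col_mx (stack l dy j) (stack l du j))).

Definition dya {R : pzRingType} {na m p : nat} (Aa : 'M[R]_na) (Ba : 'M[R]_(na, m))
  (Ca : 'M[R]_(p, na)) (du : nat -> 'cV[R]_m) (k : nat) : 'cV[R]_p :=
  \sum_(j < k) Ca *m Aa ^+ (k - j.+1) *m Ba *m du j.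

Definition calA {R : pzRingType} {p m l N : nat}
  (Ps0 : 'M[R]_(p * l + m * l, N)) (Th : 'M[R]_(p + (p * l + m * l))) :=
  Ps0 *m Ps0^T - drsubmx Th.

Definition calB {R : pzRingType} {p m l N : nat}
  (Ps1 Ps0 : 'M[R]_(p * l + m * l, N)) (Th : 'M[R]_(p + (p * l + m * l))) :=
  - ((Lmx p m l)^T *m Ps1 *m Ps0^T) + ursubmx Th.

Definition calC {R : pzRingType} {p m l N : nat}
  (Ps1 : 'M[R]_(p * l + m * l, N)) (Th : 'M[R]_(p + (p * l + m * l))) :=
  (Lmx p m l)^T *m Ps1 *m Ps1^T *m Lmx p m l - ulsubmx Th.

Definition posdef {R : numDomainType} {k : nat} (M : 'M[R]_k) :=
  M^T = M /\ forall v : 'cV[R]_k, v != 0 -> 0 < (v^T *m M *m v) ord0 ord0.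
Definition possemidef {R : numDomainType} {k : nat} (M : 'M[R]_k) :=
  M^T = M /\ forall v : 'cV[R]_k, 0 <= (v^T *m M *m v) ord0 ord0.
Definition negdef {R : numDomainType} {k : nat} (M : 'M[R]_k) := posdef (- M).

Definition lmi_mx {R : pzRingType} {p m l : nat} (P : 'M[R]_(p * l + m * l))
  (Y : 'M[R]_(m, p * l + m * l)) (cA : 'M[R]_(p * l + m * l))
  (cB : 'M[R]_(p, p * l + m * l)) (cC : 'M[R]_p)
  : 'M[R]_(p * l + m * l + (p * l + m * l) + (p * l + m * l)) :=
  let L := Lmx p m l in let F := Fmx p m l in let Bl := Bmx p m l in
  block_mx
    (block_mx (- P - L *m cC *m L^T) (F *m P + Bl *m Y)
              (P *m F^T + Y^T *m Bl^T) (- P))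
    (col_mx (L *m cB) (- P))
    (row_mx (cB^T *m L^T) (- P))
    (- cA).

Definition clstep {R : pzRingType} {n m p na : nat} (l : nat)
  (A : 'M[R]_n) (B : 'M[R]_(n, m)) (C : 'M[R]_(p, n))
  (Aa : 'M[R]_na) (Ba : 'M[R]_(na, m)) (Ca : 'M[R]_(p, na))
  (K : 'M[R]_(m, p * l + m * l))
  (z : 'cV[R]_n * 'cV[R]_na * 'cV[R]_(p * l + m * l))
  : 'cV[R]_n * 'cV[R]_na * 'cV[R]_(p * l + m * l) :=
  let: (x, xa, chi) := z in
  let y := C *m x in
  let u := K *m chi in
  (A *m x + B *m u,
   Aa *m xa + Ba *m u,
   Lmx p m l *m Ca *m xa + (Fmx p m l + Bmx p m l *m K) *m chi + Lmx p m l *m y).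

Definition sqnorm {R : pzRingType} {k : nat} (v : 'cV[R]_k) : R :=
  \sum_(i < k) v i ord0 ^+ 2.

Definition state_sqnorm {R : pzRingType} {n na N : nat}
  (z : 'cV[R]_n * 'cV[R]_na * 'cV[R]_N) : R :=
  sqnorm z.1.1 + sqnorm z.1.2 + sqnorm z.2.

(** Global asymptotic stability of the origin for z+ = f z, where nrm z measures
    the (squared Euclidean) distance of z to the origin: Lyapunov stability and
    global attractivity. *)
Definition GAS {R : numDomainType} {S : Type} (f : S -> S) (nrm : S -> R) :=
  (forall eps : R, 0 < eps -> exists2 delta : R, 0 < delta &
     forall z, nrm z < delta -> forall k, nrm (iter k f z) < eps) /\
  (forall z (eps : R), 0 < eps -> exists K : nat,
     forall k, (K <= k)%N -> nrm (iter k f z) < eps).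

(* Main.v *)
Require Import Defs.
From HB Require Import structures.
From mathcomp Require Import all_boot all_order all_algebra.
From mathcomp Require Import reals ring lra.
Import Order.TTheory GRing.Theory Num.Theory.
Local Open Scope ring_scope.

Set Implicit Arguments. Unset Strict Implicit. Unset Printing Implicit Defensive.

(** Moving the noise that enters the artificial state to the output, the data are
    a noisy window of the augmented plant [xi = (x, xa)] driven by the actual
    input. Its [l]-step observability matrix is square; a vector in its left
    kernel would annihilate the noise-free data and contradict
    [Psi0 Psi0^T > Theta22 >= D0 D0^T], so the augmented plant is observable
    although the artificial dynamics are arbitrary. Hence the output is a linear
    function [Z] of the window of the last [l] outputs and inputs, and the noise
    bound turns into the quadratic matrix inequality
    [calC + calB Z^T + Z calB^T + Z calA Z^T <= 0]. With the LMI it makes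
    [chi^T P^-1 chi] a strict Lyapunov function of [F + B K + L Z]. In closed loop
    the controller state [chi] is such a window after [l] steps; from then on it
    follows [F + B K + L Z] and determines [xi]. *)

(** * Bilinear forms and positive definite matrices *)

(** Rectangular matrices are allowed so that the off-diagonal blocks of a symmetric block matrix are
    forms too. *)
Definition bform {R : pzRingType} {m n : nat} (M : 'M[R]_(m, n)) (u : 'cV[R]_m)
  (v : 'cV[R]_n) : R := (u^T *m M *m v) ord0 ord0.

Section BilinearForms.
Variable R : comPzRingType.
Implicit Types m n k : nat.

Lemma bformD m n (M1 M2 : 'M[R]_(m, n)) u v :
  bform (M1 + M2) u v = bform M1 u v + bform M2 u v.
Proof. by rewrite /bform mulmxDr mulmxDl mxE. Qed.

Lemma bformN m n (M : 'M[R]_(m, n)) u v : bform (- M) u v = - bform M u v.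
Proof. by rewrite /bform mulmxN mulNmx mxE. Qed.

Lemma bformDl m n (M : 'M[R]_(m, n)) u1 u2 v :
  bform M (u1 + u2) v = bform M u1 v + bform M u2 v.
Proof. by rewrite /bform linearD !mulmxDl mxE. Qed.

Lemma bformDr m n (M : 'M[R]_(m, n)) u v1 v2 :
  bform M u (v1 + v2) = bform M u v1 + bform M u v2.
Proof. by rewrite /bform mulmxDr mxE. Qed.

Lemma bformZl m n (M : 'M[R]_(m, n)) a u v :
  bform M (a *: u) v = a * bform M u v.
Proof. by rewrite /bform linearZ /= -!scalemxAl mxE. Qed.

Lemma bformZr m n (M : 'M[R]_(m, n)) a u v :
  bform M u (a *: v) = a * bform M u v.
Proof. by rewrite /bform -scalemxAr mxE. Qed.

Lemma bformNl m n (M : 'M[R]_(m, n)) u v : bform M (- u) v = - bform M u v.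
Proof. by rewrite /bform linearN !mulNmx mxE. Qed.

Lemma bformNr m n (M : 'M[R]_(m, n)) u v : bform M u (- v) = - bform M u v.
Proof. by rewrite /bform mulmxN mxE. Qed.

Lemma bform_mulr m n k (M : 'M[R]_(m, n)) (N : 'M[R]_(n, k)) u v :
  bform (M *m N) u v = bform M u (N *m v).
Proof. by rewrite /bform !mulmxA. Qed.

Lemma bform_mull m n k (M : 'M[R]_(m, n)) (N : 'M[R]_(n, k)) u v :
  bform (M *m N) u v = bform N (M^T *m u) v.
Proof. by rewrite /bform trmx_mul trmxK !mulmxA. Qed.

Lemma bform1r m n (M : 'M[R]_(m, n)) u v : bform M u v = bform 1%:M u (M *m v).
Proof. by rewrite -bform_mulr mul1mx. Qed.

Lemma bform_tr m n (M : 'M[R]_(m, n)) u v : bform M^T u v = bform M v u.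
Proof.
by rewrite /bform -[RHS]mulr1 -[LHS]mulr1 -[in LHS](trmxK (_ *m v)) mxE
  !trmx_mul !trmxK mulmxA.
Qed.

Lemma bform_block m1 m2 n1 n2 (M11 : 'M[R]_(m1, n1)) M12 M21 (M22 : 'M_(m2, n2))
    u1 u2 v1 v2 :
  bform (block_mx M11 M12 M21 M22) (col_mx u1 u2) (col_mx v1 v2) =
  bform M11 u1 v1 + bform M12 u1 v2 + bform M21 u2 v1 + bform M22 u2 v2.
Proof.
rewrite /bform tr_col_mx mul_row_block mul_row_col !mulmxDl !mxE.
by rewrite addrACA !addrA.
Qed.

Lemma bform_col m1 m2 n (M1 : 'M[R]_(m1, n)) (M2 : 'M_(m2, n)) u1 u2 v :
  bform (col_mx M1 M2) (col_mx u1 u2) v = bform M1 u1 v + bform M2 u2 v.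
Proof. by rewrite /bform tr_col_mx mul_row_col mulmxDl mxE. Qed.

Lemma bform_row m n1 n2 (M1 : 'M[R]_(m, n1)) (M2 : 'M_(m, n2)) u v1 v2 :
  bform (row_mx M1 M2) u (col_mx v1 v2) = bform M1 u v1 + bform M2 u v2.
Proof. by rewrite /bform mul_mx_row mul_row_col mxE. Qed.

Lemma sqnormE n (v : 'cV[R]_n) : sqnorm v = bform 1%:M v v.
Proof.
by rewrite /sqnorm /bform mulmx1 mxE; apply: eq_bigr => i _; rewrite mxE expr2.
Qed.

Lemma bform_gram m n (M : 'M[R]_(m, n)) u :
  bform (M *m M^T) u u = sqnorm (M^T *m u).
Proof. by rewrite sqnormE bform_mull bform1r. Qed.

Lemma sqnorm_col m n (u : 'cV[R]_m) (v : 'cV[R]_n) :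
  sqnorm (col_mx u v) = sqnorm u + sqnorm v.
Proof.
by rewrite /sqnorm big_split_ord; congr (_ + _); apply: eq_bigr => i _;
  rewrite ?col_mxEu ?col_mxEd.
Qed.

End BilinearForms.

Section PositiveDefinite.
Variable R : realFieldType.
Implicit Types n : nat.

Lemma sqnorm_ge0 n (v : 'cV[R]_n) : 0 <= sqnorm v.
Proof. by apply: sumr_ge0 => i _; apply: sqr_ge0. Qed.

Lemma posdef_sym n (M : 'M[R]_n) u v : posdef M -> bform M u v = bform M v u.
Proof. by case=> Msym _; rewrite -[in LHS]Msym bform_tr. Qed.

Lemma posdef_ge0 n (M : 'M[R]_n) v : posdef M -> 0 <= bform M v v.
Proof.
case=> _ Mpos; have [->|/Mpos/ltW//] := eqVneq v 0.
by rewrite /bform mulmx0 mxE.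
Qed.

Lemma posdef_cauchy_schwarz n (M : 'M[R]_n) u v : posdef M ->
  bform M u v ^+ 2 <= bform M u u * bform M v v.
Proof.
move=> Mpos; have [->|v0] := eqVneq v 0.
  by rewrite /bform !mulmx0 !mxE expr0n mulr0.
have qv : 0 < bform M v v by case: (Mpos) => _; apply.
(* With [q] the quadratic form of [M], its value at [q(v) u - M(u,v) v] is
   [q(v) (q(u) q(v) - M(u,v)^2)]. *)
have := posdef_ge0 (bform M v v *: u + (- bform M u v) *: v) Mpos.
rewrite !(bformDl, bformDr, bformZl, bformZr) (posdef_sym v u Mpos) => h.
by rewrite -subr_ge0 -(pmulr_rge0 _ qv); move: h; congr (0 <= _); ring.
Qed.

Lemma posdef_unit n (M : 'M[R]_n) : posdef M -> M \in unitmx.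
Proof.
move=> Mpos; rewrite -row_free_unit; apply: inj_row_free => v vM.
apply: trmx_inj; rewrite trmx0; apply/eqP; apply: contraT => vn0.
by case: Mpos => _ /(_ _ vn0); rewrite trmxK vM mul0mx mxE ltxx.
Qed.

Lemma posdef_inv n (M : 'M[R]_n) : posdef M -> posdef (invmx M).
Proof.
move=> Mpos; have Mu := posdef_unit Mpos; case: (Mpos) => Msym Mgt0.
split=> [|v vn0]; first by rewrite trmx_inv Msym.
have := Mgt0 (invmx M *m v); rewrite trmx_mul trmx_inv Msym !mulmxA mulmxKV //.
apply; apply: contra_neq vn0 => v0.
by rewrite -[v](mulKVmx Mu) v0 mulmx0.
Qed.

Lemma posdef1 n : posdef (1%:M : 'M[R]_n).
Proof.
split=> [|v vn0]; first by rewrite trmx1.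
change (0 < bform 1%:M v v); rewrite -sqnormE lt_def sqnorm_ge0 andbT.
apply: contra_neq vn0 => /eqP; rewrite psumr_eq0 => [/allP h|i _]; last exact: sqr_ge0.
apply/colP => i; have := h i (mem_index_enum _).
by rewrite sqrf_eq0 !mxE => /eqP.
Qed.

(* Each coordinate of [M *m v] is the inner product of [v] with a row of [M]. *)
Lemma sqnorm_mul_bound m n (M : 'M[R]_(m, n)) :
  exists2 c, 0 < c & forall v, sqnorm (M *m v) <= c * sqnorm v.
Proof.
pose c := \sum_i sqnorm (row i M)^T.
have c0 : 0 <= c by apply: sumr_ge0 => i _; apply: sqnorm_ge0.
exists (c + 1) => [|v]; first exact: ltr_wpDl.
apply: (@le_trans _ _ (c * sqnorm v)); last first.
  by rewrite ler_wpM2r ?sqnorm_ge0// lerDl.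
rewrite /c mulr_suml; apply: ler_sum => i _.
have := posdef_cauchy_schwarz (row i M)^T v (posdef1 n).
by rewrite -!sqnormE /bform trmxK mulmx1 -row_mul mxE.
Qed.

(** Expanding [|M v - v|^2 >= 0] gives [2 v^T M v <= |M v|^2 + |v|^2]. *)
Lemma bform_le_sqnorm n (M : 'M[R]_n) :
  exists2 c, 0 < c & forall v, bform M v v <= c * sqnorm v.
Proof.
have [c c0 hc] := sqnorm_mul_bound M; exists (c + 1); first exact: addr_gt0.
move=> v; have := hc v; have := sqnorm_ge0 (M *m v - v).
rewrite !sqnormE bformDl !bformDr !(bformNl, bformNr) opprK.
rewrite (posdef_sym v (M *m v) (posdef1 n)) -!sqnormE.
have -> : bform 1%:M (M *m v) v = bform M v v.
  by rewrite (posdef_sym _ _ (posdef1 n)) -bform_mulr mul1mx.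
by have := sqnorm_ge0 v; have := sqnorm_ge0 (M *m v); lra.
Qed.

(* The coordinate [v i] is the [M]-inner product of [v] with [invmx M e_i], so
   Cauchy-Schwarz bounds it without any appeal to compactness. *)
Lemma posdef_coercive n (M : 'M[R]_n) : posdef M ->
  exists2 c, 0 < c & forall v, sqnorm v <= c * bform M v v.
Proof.
move=> Mpos; have Mu := posdef_unit Mpos; have [Msym _] := Mpos.
pose e i := invmx M *m delta_mx i ord0 : 'cV[R]_n.
pose c := \sum_i bform M (e i) (e i).
have c0 : 0 <= c by apply: sumr_ge0 => i _; apply: posdef_ge0.
exists (c + 1) => [|v]; first exact: ltr_wpDl.
apply: (@le_trans _ _ (c * bform M v v)); last first.
  by rewrite ler_wpM2r ?posdef_ge0// lerDl.
rewrite /c mulr_suml; apply: ler_sum => i _.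
have := posdef_cauchy_schwarz (e i) v Mpos.
suff -> : bform M (e i) v = v i ord0 by [].
rewrite /bform trmx_mul trmx_inv Msym -!mulmxA mulKmx // trmx_delta.
by rewrite -rowE mxE.
Qed.

End PositiveDefinite.

(** * Lyapunov functions *)

Section Decay.
Variable R : archiRealFieldType.

(* A decay rate [1 / k] is enough for asymptotic stability and follows from a
   strict Lyapunov function by a one-line induction. *)
Definition harmonic_decay (S : Type) (f : S -> S) (nrm : S -> R) :=
  exists c : R, exists2 e : R, 0 < c /\ 0 < e &
    forall k z, nrm (iter k f z) * (1 + k%:R * e) <= c * nrm z.

Lemma harmonic_decay_GAS (S : Type) (f : S -> S) (nrm : S -> R) :
  (forall z, 0 <= nrm z) -> harmonic_decay f nrm -> GAS f nrm.
Proof.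
move=> nrm0 [c [e [c0 e0] dec]]; split=> [eps eps0 | z eps eps0].
  exists (eps / c) => [|z zlt k]; first exact: divr_gt0.
  apply: le_lt_trans (_ : c * nrm z < eps); last by rewrite mulrC -ltr_pdivlMr.
  apply: le_trans (dec k z); rewrite ler_peMr // lerDl.
  by rewrite mulr_ge0 ?ler0n // ltW.
have d0 : 0 < e * eps by apply: mulr_gt0.
have cz0 : 0 <= c * nrm z by rewrite mulr_ge0 // ltW.
(* [K] exceeds [c * nrm z / (e * eps)]; a norm of at least [eps] at some [k >= K] would violate the
   decay bound. *)
have := archi_boundP (divr_ge0 cz0 (ltW d0)).
set K := Num.bound _; rewrite ltr_pdivrMr // => hK; exists K => k leKk.
rewrite ltNge; apply/negP => epsle.
have leR : K%:R <= k%:R :> R by rewrite ler_nat.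
have h1 : K%:R * (e * eps) <= k%:R * (e * eps) by rewrite ler_pM2r.
have ke0 : 0 <= 1 + k%:R * e :> R by rewrite addr_ge0 ?mulr_ge0 ?ler0n // ltW.
have h2 := ler_wpM2r ke0 epsle.
by have h3 := dec k z; lra.
Qed.

Lemma lyapunov_decay N (M V : 'M[R]_N) : posdef V -> posdef (V - M^T *m V *m M) ->
  harmonic_decay (fun v => M *m v) (@sqnorm R N).
Proof.
move=> Vpos Wpos.
have [cV cV0 hV] := posdef_coercive Vpos.
have [cW cW0 hW] := posdef_coercive Wpos.
have [d d0 hd] := bform_le_sqnorm V.
(* The form of [V] is at most [d |v|^2], hence at most [d * cW] times the decrease form
   [V - M^T V M]; so each step loses at least the fraction [e]. *)
pose e := (d * cW)^-1; have e0 : 0 < e by rewrite invr_gt0 mulr_gt0.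
have step v : bform V (M *m v) (M *m v) <= (1 - e) * bform V v v.
  have : e * bform V v v <= bform (V - M^T *m V *m M) v v.
    rewrite /e ler_pdivrMl ?mulr_gt0 // -mulrA.
    by apply: le_trans (hd v) _; rewrite ler_pM2l.
  by rewrite bformD bformN bform_mulr bform_mull trmxK; lra.
have dec k v : bform V (iter k (fun w : 'cV_N => M *m w) v) (iter k (fun w : 'cV_N => M *m w) v) * (1 + k%:R * e)
    <= bform V v v.
  elim: k => [|k IHk] /=; first by rewrite mul0r addr0 mulr1.
  apply: le_trans IHk; set w := iter k _ v.
  have a0 : 0 <= 1 + k.+1%:R * e by rewrite addr_ge0 ?mulr_ge0 ?ler0n // ltW.
  apply: le_trans (ler_wpM2r a0 (step w)) _.
  rewrite [X in X * _]mulrC -mulrA ler_wpM2l ?posdef_ge0 //.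
  (* The induction closes because [(1 - e)(1 + (k+1) e) = 1 + k e - (k+1) e^2]. *)
  have : 0 <= k.+1%:R * e ^+ 2 by rewrite mulr_ge0 ?ler0n ?sqr_ge0.
  by rewrite -natr1; lra.
exists (cV * d), e; first by split; first exact: mulr_gt0.
move=> k v.
have a0 : 0 <= 1 + k%:R * e by rewrite addr_ge0 ?mulr_ge0 ?ler0n // ltW.
apply: le_trans (ler_wpM2r a0 (hV _)) _.
rewrite -!mulrA ler_pM2l //; exact: le_trans (dec k v) (hd v).
Qed.

Lemma iter_mulmx N (M : 'M[R]_N) k v : iter k (fun w : 'cV_N => M *m w) v = M ^+ k *m v.
Proof.
elim: k => [|k IHk] /=; first by rewrite expr0 mul1mx.
by rewrite IHk exprS -mulmxE mulmxA.
Qed.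

(** Transfers decay to a system that follows [M] only after a transient of [l] steps: the finitely
    many powers of [G] before that are bounded uniformly, and the delay costs a constant factor. *)
Lemma decay_factor l N N' (G : 'M[R]_N) (M : 'M[R]_N') (E : 'M_(N, N'))
    (H : 'M_(N', N)) :
  (forall k (v : 'cV_N), G ^+ (k + l) *m v = E *m (M ^+ k *m (H *m v))) ->
  harmonic_decay (fun v => M *m v) (@sqnorm R N') ->
  harmonic_decay (fun v => G *m v) (@sqnorm R N).
Proof.
move=> GE [c [e [c0 e0] dec]].
have [cE cE0 hE] := sqnorm_mul_bound E; have [cH cH0 hH] := sqnorm_mul_bound H.
have [g [g0 hg]] : exists g, 0 <= g /\
    forall k, (k < l)%N -> forall v, sqnorm (G ^+ k *m v) <= g * sqnorm v.
  elim: l {GE} => [|l' [g [g0 hg]]]; first by exists 0; split => // ?; rewrite ltn0.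
  have [g' g'0 hg'] := sqnorm_mul_bound (G ^+ l').
  exists (g + g'); split=> [|k]; first by rewrite addr_ge0 // ltW.
  rewrite ltnS leq_eqVlt => /orP[/eqP -> | kl] v; rewrite mulrDl.
    by apply: le_trans (hg' v) _; rewrite lerDr mulr_ge0 ?sqnorm_ge0.
  by apply: le_trans (hg k kl v) _; rewrite lerDl mulr_ge0 ?sqnorm_ge0 ?ltW.
pose d := 1 + l%:R * e.
have d0 : 0 < d by rewrite ltr_wpDr // mulr_ge0 ?ler0n // ltW.
have cc0 : 0 < cE * c * cH by rewrite !mulr_gt0.
exists ((cE * c * cH + g) * d), e; first by split; rewrite // mulr_gt0 // ltr_wpDr.
have rate0 j : 0 <= 1 + j%:R * e :> R by rewrite addr_ge0 ?mulr_ge0 ?ler0n // ltW.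
move=> k v; rewrite iter_mulmx; have sv := sqnorm_ge0 v.
have [kl|lk] := ltnP k l.
  apply: le_trans (ler_wpM2r (rate0 k) (hg k kl v)) _.
  have kd : 1 + k%:R * e <= d by rewrite lerD2l ler_pM2r // ler_nat ltnW.
  apply: le_trans (ler_wpM2l (mulr_ge0 g0 sv) kd) _.
  by rewrite mulrAC ler_wpM2r // ler_pM2r // lerDr ltW.
rewrite -(subnK lk) GE; set j := (k - l)%N; rewrite natrD.
set w := H *m v; have := dec j w; rewrite iter_mulmx => hj.
have s0 := sqnorm_ge0 (M ^+ j *m w).
(* The rate is submultiplicative, so the delay [l] is absorbed by the factor [d = 1 + l e]. *)
have hjd : 1 + (j%:R + l%:R) * e <= (1 + j%:R * e) * d.
  have : 0 <= (j%:R * e) * (l%:R * e) by rewrite !mulr_ge0 ?ler0n // ltW.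
  by rewrite /d; lra.
have := rate0 (j + l)%N; rewrite natrD => r0.
apply: le_trans (ler_wpM2r r0 (hE _)) _.
apply: le_trans (ler_wpM2l (mulr_ge0 (ltW cE0) s0) hjd) _.
apply: (@le_trans _ _ (cE * (c * (cH * sqnorm v)) * d)).
  rewrite mulrA ler_wpM2r ?(ltW d0) // -mulrA ler_wpM2l ?(ltW cE0) //.
  by apply: le_trans hj _; rewrite ler_pM2l // hH.
rewrite [leRHS]mulrAC ler_pM2r // !mulrA mulrDl lerDl.
exact: mulr_ge0.
Qed.

End Decay.

(** * Stacked windows *)

(** Left multiplication extracts block [i] of a stacked vector; the transpose puts a block back in
    that position. *)
Definition blockmx {R : pzRingType} (q l i : nat) : 'M[R]_(q, q * l) :=
  \matrix_(r, c) ((nat_of_ord c == q * i + r)%N)%:R.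

Section Stacks.
Variable R : pzRingType.
Implicit Types q l i : nat.

Lemma blk_lt q l i (r : 'I_q) : (i < l)%N -> (q * i + r < q * l)%N.
Proof.
move=> il; have := ltn_ord r; rewrite -[in X in X -> _](ltn_add2l (q * i)) => h.
by apply: leq_trans h _; rewrite -mulnSr leq_mul2l il orbT.
Qed.

Lemma blk_gt0 q l (r : 'I_(q * l)) : (0 < q)%N.
Proof. by case: q r => [|//] [r]; rewrite mul0n. Qed.

Lemma blk_div_lt q l (r : 'I_(q * l)) : (r %/ q < l)%N.
Proof. by have q0 := blk_gt0 r; case: r => r' rl /=; rewrite ltn_divLR // mulnC. Qed.

Lemma blk_recompose q l (r : 'I_(q * l)) : (q * (r %/ q) + r %% q = r)%N.
Proof. by rewrite mulnC -divn_eq. Qed.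

Lemma blockmx_mul q l i k (M : 'M[R]_(q * l, k)) (r : 'I_q) c (il : (i < l)%N) :
  (blockmx q l i *m M) r c = M (Ordinal (blk_lt r il)) c.
Proof.
rewrite mxE (bigD1 (Ordinal (blk_lt r il))) //= mxE eqxx mul1r big1 ?addr0 //.
move=> j jr; rewrite mxE; case: eqP => [je|]; last by rewrite mul0r.
by case/eqP: jr; apply: val_inj.
Qed.

Lemma blockmx_stack q l i f s : (i < l)%N ->
  blockmx q l i *m stack l f s = f (s + i)%N :> 'cV[R]_q.
Proof.
move=> il; apply/colP => r; rewrite (blockmx_mul _ _ _ il) mxE /=.
have q0 : (0 < q)%N by apply: leq_ltn_trans (ltn_ord r).
have -> : ((q * i + r) %/ q = i)%N.
  by rewrite mulnC divnMDl // divn_small ?addn0.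
by congr (f _ _ _); apply: val_inj; rewrite /= mulnC modnMDl modn_small.
Qed.

Lemma stack_blockmx q l (v : 'cV[R]_(q * l)) :
  stack l (fun i => blockmx q l i *m v) 0 = v.
Proof.
apply/colP => r; rewrite mxE add0n.
have q0 := blk_gt0 r.
have rl := blk_div_lt r.
rewrite (blockmx_mul _ _ _ rl); congr (v _ _); apply: val_inj => /=.
by rewrite blk_recompose.
Qed.

Lemma eq_stack q l (f g : nat -> 'cV[R]_q) s t :
  (forall i, (i < l)%N -> f (s + i)%N = g (t + i)%N) -> stack l f s = stack l g t.
Proof.
by move=> fg; apply/colP => r; rewrite !mxE fg ?blk_div_lt.
Qed.

Lemma stackD q l (f g : nat -> 'cV[R]_q) s :
  stack l (fun k => f k + g k) s = stack l f s + stack l g s.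
Proof. by apply/colP => r; rewrite !mxE. Qed.

Lemma stack_sum q l f s :
  stack l f s = \sum_(i < l) (blockmx q l i)^T *m f (s + i)%N :> 'cV[R]_(q * l).
Proof.
apply/colP => r.
have q0 := blk_gt0 r.
have rl := blk_div_lt r.
rewrite mxE summxE (bigD1 (Ordinal rl)) //= [X in _ + X]big1 => [|i ir].
  rewrite addr0 mxE (bigD1 (blk_row r)) //= big1 => [|j jr].
    by rewrite !mxE /= blk_recompose eqxx mul1r addr0.
  rewrite !mxE; case: eqP => [re|]; last by rewrite mul0r.
  case/eqP: jr; apply: val_inj => /=.
  by rewrite [in RHS]re mulnC modnMDl modn_small.
rewrite mxE big1 // => j _; rewrite !mxE; case: eqP => [re|]; last by rewrite mul0r.
case/eqP: ir; apply: val_inj => /=.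
by rewrite re mulnC divnMDl // divn_small ?addn0.
Qed.

Lemma shiftmx_stack q l (f : nat -> 'cV[R]_q) s : (0 < l)%N ->
  shiftmx q l *m stack l f s + (blockmx q l l.-1)^T *m f (s + l)%N = stack l f s.+1.
Proof.
move=> l0; apply/colP => r.
have q0 := blk_gt0 r.
have rl := blk_div_lt r.
rewrite !mxE.
(* Outside the last block, row [r] reads entry [r + q]. In the last block the row of the shift
   matrix vanishes and the new sample fills it. *)
have [rl1|rl1] := ltnP (r %/ q).+1 l.
  have cl : (r + q < q * l)%N.
    by have := blk_lt (blk_row r) rl1; rewrite /= mulnS -addnA blk_recompose addnC.
  rewrite (bigD1 (Ordinal cl)) //= big1 => [|j jr].
    rewrite !mxE /= divnDr // divnn q0 addn1 modnDr !eqxx mul1r addr0.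
    rewrite big1 => [|j _].
      rewrite addr0 addSnnS; congr (f _ _ _); apply: val_inj.
      by rewrite /= modnDr.
    rewrite !mxE; case: eqP => [re|]; last by rewrite mul0r.
    move: rl1; rewrite re mulnC divnMDl // divn_small // addn0.
    by rewrite prednK // ltnn.
  rewrite !mxE; case: andP => [[/eqP h1 /eqP h2]|]; last by rewrite mul0r.
  case/eqP: jr; apply: val_inj => /=.
  by rewrite -(blk_recompose j) -h1 -h2 mulnS -addnA blk_recompose addnC.
have rE : (r %/ q = l.-1)%N by apply/eqP; rewrite -eqSS prednK // eqn_leq rl rl1.
rewrite big1 => [|j _]; last first.
  rewrite !mxE; case: andP => [[/eqP h1 _]|]; last by rewrite mul0r.
  by have := blk_div_lt j; rewrite -h1 rE prednK // ltnn.
rewrite add0r (bigD1 (blk_row r)) //= big1 => [|j jr].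
  rewrite !mxE /= -rE blk_recompose eqxx mul1r addr0; congr (f _ _ _).
  by rewrite rE addSnnS prednK.
rewrite !mxE; case: eqP => [re|]; last by rewrite mul0r.
case/eqP: jr; apply: val_inj => /=.
by rewrite [in RHS]re mulnC modnMDl modn_small.
Qed.

Lemma Lmx_blockmx p m l : Lmx p m l = col_mx (blockmx p l l.-1)^T 0 :> 'M[R]_(_, _).
Proof.
by rewrite /Lmx; congr col_mx; apply/matrixP => r c; rewrite !mxE subn1.
Qed.

Lemma Bmx_blockmx p m l : Bmx p m l = col_mx 0 (blockmx m l l.-1)^T :> 'M[R]_(_, _).
Proof.
by rewrite /Bmx; congr col_mx; apply/matrixP => r c; rewrite !mxE subn1.
Qed.

(** [F], [L] and [B] implement two shift registers, one for outputs and one for inputs; this holds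
    for arbitrary signals, with no plant relating them. *)
Lemma FLB_stack p m l (y : nat -> 'cV[R]_p) (u : nat -> 'cV[R]_m) s : (0 < l)%N ->
  Fmx p m l *m col_mx (stack l y s) (stack l u s) + Lmx p m l *m y (s + l)%N
    + Bmx p m l *m u (s + l)%N = col_mx (stack l y s.+1) (stack l u s.+1).
Proof.
move=> l0; rewrite Lmx_blockmx Bmx_blockmx /Fmx mul_block_col !mul_col_mx !mul0mx.
by rewrite !add_col_mx add0r !addr0 !shiftmx_stack.
Qed.

End Stacks.

(** * Input-output behaviour *)

Section InputOutput.
Variables (R : comPzRingType) (N m p : nat).
Variables (A : 'M[R]_N) (B : 'M[R]_(N, m)) (C : 'M[R]_(p, N)).

(** The dynamics are required on one window only, since the data obey them only up to time [T]. *)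
Definition trajectory (xi : nat -> 'cV[R]_N) (u : nat -> 'cV[R]_m) (j l : nat) :=
  forall i, (i < l)%N -> xi (j + i).+1 = A *m xi (j + i)%N + B *m u (j + i)%N.

Fixpoint forced_response (l i : nat) : 'M[R]_(N, m * l) :=
  if i is i'.+1 then A *m forced_response l i' + B *m blockmx m l i' else 0.

Lemma trajectory_response l xi u j i : (i <= l)%N -> trajectory xi u j l ->
  xi (j + i)%N = A ^+ i *m xi j + forced_response l i *m stack l u j.
Proof.
move=> + traj; elim: i => [|i IHi] il.
  by rewrite addn0 expr0 mul1mx mul0mx addr0.
rewrite addnS traj // IHi ?(ltnW il) // exprS -mulmxE mulmxDr /= mulmxDl.
by rewrite -!mulmxA blockmx_stack // addrA.
Qed.

(** [O] is the observability matrix and [Tm] the block Toeplitz matrix of the impulse response. Only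
    this identity is needed later, so both stay existential. *)
Lemma stack_response l : exists O : 'M[R]_(p * l, N), exists Tm : 'M_(p * l, m * l),
  forall xi u j, trajectory xi u j l ->
    stack l (fun k => C *m xi k) j = O *m xi j + Tm *m stack l u j.
Proof.
exists (\sum_(i < l) (blockmx p l i)^T *m (C *m A ^+ i)).
exists (\sum_(i < l) (blockmx p l i)^T *m (C *m forced_response l i)).
move=> xi u j traj; rewrite stack_sum !mulmx_suml -big_split /=.
apply: eq_bigr => i _; rewrite (trajectory_response (ltnW (ltn_ord i)) traj).
by rewrite !mulmxDr !mulmxA.
Qed.

(** A left inverse of [O] recovers the state at the start of the window, and the recorded inputs
    carry it [l] steps forward. *)
Lemma state_of_window l (O : 'M[R]_(p * l, N)) (Tm : 'M_(p * l, m * l))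
    (O' : 'M_(N, p * l)) :
  O' *m O = 1%:M ->
  (forall xi u j, trajectory xi u j l ->
    stack l (fun k => C *m xi k) j = O *m xi j + Tm *m stack l u j) ->
  exists E : 'M_(N, p * l + m * l), forall xi u j, trajectory xi u j l ->
    xi (j + l)%N = E *m col_mx (stack l (fun k => C *m xi k) j) (stack l u j).
Proof.
move=> O'O HO.
exists (row_mx (A ^+ l *m O') (forced_response l l - A ^+ l *m O' *m Tm)).
move=> xi u j traj; rewrite (trajectory_response (leqnn l) traj) mul_row_col.
set U := stack l u j; set W := stack l _ j.
have -> : xi j = O' *m W - O' *m Tm *m U.
  by rewrite /W (HO _ _ _ traj) mulmxDr !mulmxA O'O mul1mx addrK.
by rewrite mulmxBr mulmxBl !mulmxA addrAC addrA.
Qed.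

End InputOutput.

(** * Closed loop of a plant with the window controller *)

Section ClosedLoop.
Variables (R : archiRealFieldType) (N m p l : nat).
Variables (A : 'M[R]_N) (B : 'M[R]_(N, m)) (C : 'M[R]_(p, N)).
Variables (K : 'M[R]_(m, p * l + m * l)) (E : 'M[R]_(N, p * l + m * l)).
Hypothesis l0 : (0 < l)%N.
Hypothesis HE : forall xi u j, trajectory A B xi u j l ->
    xi (j + l)%N = E *m col_mx (stack l (fun k => C *m xi k) j) (stack l u j).

(* Whatever its initial value, after [l] steps the controller state is exactly
   the window of the last [l] outputs and inputs: the shift registers encoded by
   [F], [L] and [B] have flushed it. *)
Lemma controller_window xi chi :
  (forall k, xi k.+1 = A *m xi k + B *m (K *m chi k)) ->
  (forall k, chi k.+1 = Fmx p m l *m chi k + Lmx p m l *m (C *m xi k)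
                        + Bmx p m l *m (K *m chi k)) ->
  forall k, chi (k + l)%N =
    col_mx (stack l (fun k => C *m xi k) k) (stack l (fun k => K *m chi k) k).
Proof.
move=> Hxi Hchi k.
(* The initial controller state is read as [l] fictitious samples preceding time 0, so index [i] of
   [fy] and [fu] stands for time [i - l] and [chi] is a window at every time. *)
pose ext q (w : 'cV[R]_(q * l)) (f : nat -> 'cV_q) i :=
  if (i < l)%N then blockmx q l i *m w else f (i - l)%N.
pose fy := ext p (usubmx (chi 0)) (fun k => C *m xi k).
pose fu := ext m (dsubmx (chi 0)) (fun k => K *m chi k).
have win k' : chi k' = col_mx (stack l fy k') (stack l fu k').
  elim: k' => [|k' IHk].
    rewrite -[LHS]vsubmxK -[X in col_mx X _]stack_blockmx.
    rewrite -[X in col_mx _ X]stack_blockmx.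
    by congr col_mx; apply: eq_stack => i il; rewrite /fy /fu /ext add0n il.
  rewrite -FLB_stack // -IHk Hchi /fy /fu /ext.
  by rewrite ltnNge leq_addl /= addnK.
rewrite win; congr col_mx; apply: eq_stack => i il; rewrite /fy /fu /ext.
  by rewrite addnAC ltnNge leq_addl /= addnK.
by rewrite addnAC ltnNge leq_addl /= addnK.
Qed.

(** After [l] steps the plant state is [E] times the controller state, so the latter follows [M] and
    [G ^+ (k + l)] factors through [M ^+ k]. *)
Lemma closed_loop_decay (V : 'M[R]_(p * l + m * l)) :
  let M := Fmx p m l + Bmx p m l *m K + Lmx p m l *m (C *m E) in
  posdef V -> posdef (V - M^T *m V *m M) ->
  harmonic_decay (fun v : 'cV_(N + (p * l + m * l)) =>
    block_mx A (B *m K) (Lmx p m l *m C) (Fmx p m l + Bmx p m l *m K) *m v)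
    (@sqnorm R _).
Proof.
move=> M Vpos Wpos; set G := block_mx _ _ _ _.
apply: (@decay_factor _ l _ _ G M (col_mx E 1%:M) (dsubmx (G ^+ l)));
  last exact: lyapunov_decay Vpos Wpos.
move=> k v.
pose xi j := usubmx (G ^+ j *m v); pose chi j := dsubmx (G ^+ j *m v).
have split_traj j : G ^+ j *m v = col_mx (xi j) (chi j) by rewrite vsubmxK.
have step j : col_mx (xi j.+1) (chi j.+1) = G *m col_mx (xi j) (chi j).
  by rewrite -!split_traj exprS -mulmxE mulmxA.
have Hxi j : xi j.+1 = A *m xi j + B *m (K *m chi j).
  by have := step j; rewrite mul_block_col -mulmxA => /eq_col_mx[].
have Hchi j : chi j.+1 = Fmx p m l *m chi j + Lmx p m l *m (C *m xi j)
                        + Bmx p m l *m (K *m chi j).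
  have := step j; rewrite mul_block_col mulmxDl -!mulmxA => /eq_col_mx[_ ->].
  by rewrite addrCA addrA.
have win := controller_window Hxi Hchi.
have xiE j : xi (j + l)%N = E *m chi (j + l)%N.
  by rewrite win; apply: HE => i _; apply: Hxi.
have chiM j : chi (j + l)%N = M ^+ j *m chi l.
  elim: j => [|j IHj]; first by rewrite expr0 mul1mx.
  rewrite addSn Hchi xiE exprS -mulmxE -mulmxA -IHj /M !mulmxDl -!mulmxA.
  by rewrite addrAC.
rewrite split_traj xiE chiM mul_dsub_mx -/(chi l).
by rewrite mul_col_mx mul1mx.
Qed.

End ClosedLoop.

(** * The matrix inequality and the data *)

Section MatrixInequality.
Variables (R : realFieldType) (p m l : nat).
Local Notation w := (p * l + m * l)%N.

(* Test vector [(P^-1 M chi, P^-1 chi, - Z^T L^T P^-1 M chi)] in the LMI. *)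
Lemma lmi_lyapunov (P : 'M[R]_w) (Y : 'M[R]_(m, w)) (cA : 'M[R]_w)
    (cB : 'M[R]_(p, w)) (cC : 'M[R]_p) (Z : 'M[R]_(p, w)) :
  posdef P -> negdef (lmi_mx P Y cA cB cC) ->
  (forall s, bform (block_mx cC (- cB) (- cB^T) cA) (col_mx s (- (Z^T *m s)))
                   (col_mx s (- (Z^T *m s))) <= 0) ->
  let M := Fmx p m l + Bmx p m l *m (Y *m invmx P) + Lmx p m l *m Z in
  posdef (invmx P - M^T *m invmx P *m M).
Proof.
move=> Ppos [_ Hlmi] HS M; have Pu := posdef_unit Ppos; have [Psym _] := Ppos.
have [Qsym _] := posdef_inv Ppos.
split; first by rewrite linearB /= !trmx_mul trmxK Qsym mulmxA.
move=> v vn0; change (0 < bform (invmx P - M^T *m invmx P *m M) v v).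
pose b := invmx P *m v; pose a := invmx P *m (M *m v).
pose s := (Lmx p m l)^T *m a; pose c := - (Z^T *m s).
have bn0 : b != 0.
  by apply: contra_neq vn0 => b0; rewrite -[v](mulKVmx Pu) -/b b0 mulmx0.
have /Hlmi : col_mx (col_mx a b) c != 0.
  by rewrite !col_mx_eq0 (negPf bn0) andbF.
rewrite -/(bform _ _ _) bformN oppr_gt0 /lmi_mx.
rewrite !(bform_block, bform_col, bform_row).
have := HS s; rewrite -/c bform_block.
have -> : bform (invmx P - M^T *m invmx P *m M) v v
    = bform P b b - bform P a a.
  rewrite bformD bformN; congr (_ - _).
    by rewrite /bform trmx_mul Qsym !mulmxA mulmxKV.
  rewrite /bform /a !trmx_mul Qsym !mulmxA mulmxKV //.
have Eb : (P *m (Fmx p m l)^T + Y^T *m (Bmx p m l)^T)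
          = (Fmx p m l *m P + Bmx p m l *m Y)^T.
  by rewrite linearD /= !trmx_mul Psym.
have Ec : cB^T *m (Lmx p m l)^T = (Lmx p m l *m cB)^T by rewrite trmx_mul.
rewrite Eb Ec !bform_tr.
(* Here [P b = v], so [(F P + B Y) b = M v - L Z v]; moreover [a^T M v = a^T P a] and
   [a^T L Z v = - b^T P c]. *)
have Mv : bform (Fmx p m l *m P + Bmx p m l *m Y) a b = bform P a a + bform P b c.
  have Pbc : bform P b c = - bform (Lmx p m l *m Z) a v.
    rewrite (posdef_sym _ _ Ppos) (bform1r P) mulKVmx // /c bformNl -bform_mull.
    by rewrite mulmx1 bform_mull.
  rewrite Pbc (bform1r P) mulKVmx // (bform1r (_ *m Z)) -bformNr -bformDr.
  rewrite [LHS]bform1r; congr bform; rewrite /M /b !mulmxDl -!mulmxA.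
  by rewrite mulKVmx // addrK.
(* The terms [b^T P c] cancel, and the LMI reads [b^T P b - a^T P a > - q], where [q <= 0] is the
   value bounded by [HS]. *)
rewrite Mv.
rewrite !bformD !bformN.
have -> : bform (Lmx p m l *m cC *m (Lmx p m l)^T) a a = bform cC s s.
  by rewrite bform_mulr bform_mull.
rewrite (bform_mull (Lmx p m l)) -/s !bform_tr (posdef_sym c b Ppos).
lra.
Qed.

End MatrixInequality.

(** * Data matrices and the noise bound *)

Section Columns.
Variables (R : pzRingType) (k : nat).

Lemma eq_colsmx r (f g : nat -> 'cV[R]_r) :
  (forall j, (j < k)%N -> f j = g j) -> colsmx k f = colsmx k g.
Proof. by move=> fg; apply/matrixP => i j; rewrite !mxE fg. Qed.

Lemma mul_colsmx q r (M : 'M[R]_(q, r)) f :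
  M *m colsmx k f = colsmx k (fun j => M *m f j).
Proof.
by apply/matrixP => i j; rewrite !mxE; apply: eq_bigr => h _; rewrite mxE.
Qed.

Lemma col_colsmx q r (f : nat -> 'cV[R]_q) (g : nat -> 'cV[R]_r) :
  colsmx k (fun j => col_mx (f j) (g j)) = col_mx (colsmx k f) (colsmx k g).
Proof.
by apply/matrixP => i j; rewrite !mxE; case: split => i'; rewrite mxE.
Qed.

Lemma colsmxD r (f g : nat -> 'cV[R]_r) :
  colsmx k (fun j => f j + g j) = colsmx k f + colsmx k g.
Proof. by apply/matrixP => i j; rewrite !mxE. Qed.

End Columns.

Section Data.
Variables (R : realFieldType) (p m l k : nat).
Local Notation w := (p * l + m * l)%N.
Variables (Theta : 'M[R]_(p + w)) (D1 : 'M[R]_(p, k)) (D0 Ps0 Ps1 : 'M[R]_(w, k)).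
Hypothesis HDelta : possemidef (Theta - col_mx D1 D0 *m (col_mx D1 D0)^T).

(** The block matrix is [W W^T - Theta] with [W = (L^T Psi1, Psi0)]. On vectors [(s, - Z^T s)] the
    residual identity lets [D] replace [W], and [D D^T <= Theta]. *)
Lemma data_quadratic_matrix_inequality (Z : 'M[R]_(p, w)) (s : 'cV[R]_p) :
  Theta^T = Theta ->
  (Lmx p m l)^T *m Ps1 - Z *m Ps0 = D1 - Z *m D0 ->
  bform (block_mx (calC Ps1 Theta) (- calB Ps1 Ps0 Theta) (- (calB Ps1 Ps0 Theta)^T)
                  (calA Ps0 Theta))
    (col_mx s (- (Z^T *m s))) (col_mx s (- (Z^T *m s))) <= 0.
Proof.
move=> Tsym Hres; set mu := col_mx s _.
pose W := col_mx ((Lmx p m l)^T *m Ps1) Ps0; pose D := col_mx D1 D0.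
have -> : block_mx (calC Ps1 Theta) (- calB Ps1 Ps0 Theta)
    (- (calB Ps1 Ps0 Theta)^T) (calA Ps0 Theta) = W *m W^T - Theta.
  rewrite -[Theta in RHS]submxK tr_col_mx mul_col_row opp_block_mx add_block_mx.
  rewrite /calA /calB /calC trmx_mul trmxK !mulmxA; congr block_mx.
    by rewrite opprD opprK.
  rewrite linearD linearN /= !trmx_mul !trmxK trmx_ursub Tsym opprD opprK.
  by rewrite mulmxA.
have WD : W^T *m mu = D^T *m mu.
  rewrite /mu [W^T]tr_col_mx [D^T]tr_col_mx !mul_row_col !mulmxN !mulmxA -!mulmxBl.
  by congr (_ *m _); apply: trmx_inj; rewrite !linearB /= !trmx_mul !trmxK -Hres.
have [_ /(_ mu)] := HDelta; rewrite -/(bform _ _ _) -/D.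
by rewrite !bformD !bformN !bform_gram WD; lra.
Qed.

(** Testing the noise bound on [(0, v)] gives [|D0^T v|^2 <= v^T Theta22 v], while [v != 0] would
    give [v^T Theta22 v < |Ps0^T v|^2]. *)
Lemma left_kernel_data (v : 'cV[R]_w) : posdef (Ps0 *m Ps0^T - drsubmx Theta) ->
  Ps0^T *m v = D0^T *m v -> v = 0.
Proof.
move=> [_ Hpos] Hv; apply/eqP; apply: contraT => /Hpos; rewrite -/(bform _ _ _).
have [_ /(_ (col_mx 0 v))] := HDelta; rewrite -/(bform _ _ _).
rewrite !bformD !bformN !bform_gram Hv -[X in bform X (col_mx _ _)]submxK bform_block.
rewrite [(col_mx D1 D0)^T]tr_col_mx mul_row_col mulmx0 add0r.
rewrite {1 2 3}/bform trmx0 !mulmx0 !mul0mx mxE.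
by lra.
Qed.

End Data.

(** The convolution is the output of the artificial system started at zero and driven by [du]. *)
Lemma dya_response (R : pzRingType) (na m p : nat) (Aa : 'M[R]_na)
    (Ba : 'M[R]_(na, m)) (Ca : 'M[R]_(p, na)) (du : nat -> 'cV[R]_m) :
  exists2 e : nat -> 'cV[R]_na, forall k, e k.+1 = Aa *m e k + Ba *m du k
    & forall k, dya Aa Ba Ca du k = Ca *m e k.
Proof.
exists (fun k => \sum_(j < k) Aa ^+ (k - j.+1) *m Ba *m du j) => k.
  rewrite big_ord_recr /= subnn expr0 mul1mx mulmx_sumr; congr (_ + _).
  by apply: eq_bigr => j _; rewrite subSn // exprS -mulmxE !mulmxA.
by rewrite mulmx_sumr; apply: eq_bigr => j _; rewrite !mulmxA.
Qed.

(** * The closed loop as one linear map on stacked states *)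

Section Vectorization.
Variables (R : archiRealFieldType) (n m p na l : nat).
Variables (A : 'M[R]_n) (B : 'M[R]_(n, m)) (C : 'M[R]_(p, n)).
Variables (Aa : 'M[R]_na) (Ba : 'M[R]_(na, m)) (Ca : 'M[R]_(p, na)).
Variable K : 'M[R]_(m, p * l + m * l).

Lemma clstep_decay :
  harmonic_decay (fun v : 'cV_(n + na + (p * l + m * l)) =>
    block_mx (block_mx A 0 0 Aa) (col_mx B Ba *m K) (Lmx p m l *m row_mx C Ca)
      (Fmx p m l + Bmx p m l *m K) *m v) (@sqnorm R _) ->
  harmonic_decay (clstep A B C Aa Ba Ca K) state_sqnorm.
Proof.
set G := block_mx _ _ _ _; move=> [c [e ce dec]]; exists c, e => // k z.
pose vec (z : 'cV[R]_n * 'cV[R]_na * 'cV[R]_(p * l + m * l)) :=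
  col_mx (col_mx z.1.1 z.1.2) z.2.
have vecE z' : state_sqnorm z' = sqnorm (vec z') by rewrite /vec !sqnorm_col.
have step z' : vec (clstep A B C Aa Ba Ca K z') = G *m vec z'.
  case: z' => [[x xa] chi]; rewrite /vec /G /clstep.
  move: (Lmx p m l) (Fmx p m l) (Bmx p m l) => L F Bl /=.
  rewrite !mul_block_col !mul_col_mx !mul0mx addr0 add0r -!mulmxA mul_row_col.
  rewrite add_col_mx mulmxDr; congr col_mx.
  by rewrite -[LHS]addrA [RHS]addrAC [RHS]addrC [X in _ = _ + X]addrC.
have -> : state_sqnorm (iter k (clstep A B C Aa Ba Ca K) z)
    = sqnorm (iter k (fun v => G *m v) (vec z)).
  by rewrite vecE; congr sqnorm; elim: k => //= k <-; rewrite step.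
by rewrite vecE; apply: dec.
Qed.

End Vectorization.

(** * Stability of the interconnection from noisy data *)

Theorem theorem2 (R : realType) (n m p l T : nat)
  (A : 'M[R]_n) (B : 'M[R]_(n, m)) (C : 'M[R]_(p, n))
  (Hobs : observable A C) (Hidx : obs_index A C l) (Hpl : (n < p * l)%N)
  (Aa : 'M[R]_(p * l - n)) (Ba : 'M[R]_(p * l - n, m)) (Ca : 'M[R]_(p, p * l - n))
  (um du : nat -> 'cV[R]_m) (dy ym : nat -> 'cV[R]_p)
  (x : nat -> 'cV[R]_n) (xam : nat -> 'cV[R]_(p * l - n))
  (Hx : forall k, (k <= T)%N -> x k.+1 = A *m x k + B *m (um k - du k))
  (Hxa : forall k, (k <= T)%N -> xam k.+1 = Aa *m xam k + Ba *m um k)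
  (Hy : forall k, (k <= T)%N -> ym k = C *m x k + dy k + Ca *m xam k)
  (Theta : 'M[R]_(p + (p * l + m * l)))
  (HTheta : possemidef Theta)
  (HDelta : possemidef
     (Theta - Delta10 l T (fun k => dy k + dya Aa Ba Ca du k) du
              *m (Delta10 l T (fun k => dy k + dya Aa Ba Ca du k) du)^T))
  (HPsi0 : posdef (Psi0 l T ym um *m (Psi0 l T ym um)^T - drsubmx Theta))
  (Y : 'M[R]_(m, p * l + m * l)) (P : 'M[R]_(p * l + m * l))
  (HP : posdef P)
  (HLMI : negdef (lmi_mx P Y
            (calA (Psi0 l T ym um) Theta)
            (calB (Psi1 l T ym um) (Psi0 l T ym um) Theta)
            (calC (Psi1 l T ym um) Theta))) :
  GAS (clstep A B C Aa Ba Ca (Y *m invmx P)) state_sqnorm.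
Proof.
have l0 : (0 < l)%N by rewrite lt0n; apply: contraTneq Hpl => ->; rewrite muln0.
have NE : (n + (p * l - n) = p * l)%N by rewrite subnKC // ltnW.
pose Ab : 'M[R]_(n + (p * l - n)) := block_mx A 0 0 Aa.
pose Bb := col_mx B Ba; pose Cb := row_mx C Ca.
have [O [Tm HO]] := stack_response Ab Bb Cb l.
have [e eS dyaE] := dya_response Aa Ba Ca du.
pose d k := dy k + dya Aa Ba Ca du k.
(* The noise reaching the artificial state is moved to the output, so that the
   augmented plant is driven by the actual input [um - du]. *)
pose xi k := col_mx (x k) (xam k - e k); pose v k := um k - du k.
have dyn k : (k <= T)%N -> xi k.+1 = Ab *m xi k + Bb *m v k.
  move=> kT; rewrite /xi /Ab /Bb mul_block_col !mul_col_mx !mul0mx addr0 add0r.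
  rewrite add_col_mx Hx // Hxa // eS /v !mulmxBr; congr col_mx.
  by rewrite opprD addrACA.
have out k : (k <= T)%N -> ym k = Cb *m xi k + d k.
  move=> kT; rewrite Hy // /xi /Cb mul_row_col /d dyaE mulmxBr.
  by rewrite -!addrA; congr (_ + _); rewrite [X in _ = _ + X]addrCA addNr addr0 addrC.
(* A column index satisfies [j + l <= T], so its whole window lies where the dynamics hold. *)
have traj j : (j < T.+1 - l)%N -> trajectory Ab Bb xi v j l.
  move=> jT i il; apply: dyn; move: jT; rewrite ltn_subRL ltnS; apply: leq_trans.
  by rewrite addnC leq_add2r ltnW.
pose wy j := stack l (fun k => Cb *m xi k) j.
pose D1 := colsmx (T.+1 - l) (fun j => d (j + l)%N).
pose D0 := colsmx (T.+1 - l) (fun j => col_mx (stack l d j) (stack l du j)).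
have DE : Delta10 l T d du = col_mx D1 D0 by rewrite /Delta10 col_colsmx.
rewrite -/d DE in HDelta.
pose W := colsmx (T.+1 - l) (fun j => col_mx (wy j) (stack l v j)).
(* [W] collects the noise-free windows of the augmented plant. *)
have Psi0E : Psi0 l T ym um = W + D0.
  rewrite -colsmxD; apply: eq_colsmx => j jT; rewrite add_col_mx -!stackD.
  congr col_mx; apply: eq_stack => i il; last by rewrite subrK.
  apply: out; move: jT; rewrite ltn_subRL ltnS; apply: leq_trans.
  by rewrite addnC leq_add2r ltnW.
have freeO : row_free O.
  apply: inj_row_free => r rO.
  (* If [r O = 0], each noise-free window satisfies [r wy = r Tm U], with [U] its stacked input, so
     [(r, - r Tm)] annihilates [W]. *)
  have := @left_kernel_data _ _ _ _ _ _ _ _ _ HDelta (col_mx r^T (- (r *m Tm)^T)) HPsi0.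
  rewrite Psi0E linearD mulmxDl => ker.
  suff WO : W^T *m col_mx r^T (- (r *m Tm)^T) = 0.
    move: ker; rewrite WO add0r => /(_ erefl) /eqP; rewrite col_mx_eq0 => /andP[/eqP r0 _].
    by apply: trmx_inj; rewrite r0 trmx0.
  apply: trmx_inj; rewrite trmx_mul trmxK tr_col_mx linearN /= !trmxK trmx0 mul_colsmx.
  transitivity (colsmx (T.+1 - l) (fun=> 0 : 'cV[R]_1)); last first.
    by apply/matrixP => i j; rewrite !mxE.
  apply: eq_colsmx => j jT; rewrite mul_row_col mulNmx /wy (HO _ _ _ (traj _ jT)).
  by rewrite mulmxDr !mulmxA rO mul0mx add0r subrr.
(* [O] is square by [NE], so independent rows give full column rank. *)
have [O' O'O] : exists O', O' *m O = 1%:M.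
  by apply/row_fullP; rewrite /row_full (eqP freeO) NE.
have [E HE] := state_of_window O'O HO.
pose Z := Cb *m E.
(* [Z] predicts the next noise-free output exactly from the noise-free window, so only noise remains
   in the residual. *)
have Hres : (Lmx p m l)^T *m Psi1 l T ym um - Z *m Psi0 l T ym um = D1 - Z *m D0.
  apply/eqP; rewrite Psi0E mulmxDr opprD addrA (inj_eq (addIr _)) subr_eq.
  rewrite mul_colsmx mul_colsmx -colsmxD; apply/eqP; apply: eq_colsmx => j jT.
  rewrite Lmx_blockmx tr_col_mx trmxK trmx0 mul_row_col mul0mx addr0.
  rewrite blockmx_stack ?prednK // addSnnS prednK // out.
    by rewrite (HE _ _ _ (traj _ jT)) mulmxA addrC.
  by move: jT; rewrite ltn_subRL ltnS addnC.
apply: harmonic_decay_GAS.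
  by move=> z; rewrite !addr_ge0 ?sqnorm_ge0.
apply/clstep_decay/(closed_loop_decay l0 HE (posdef_inv HP)).
rewrite -/Z; apply: lmi_lyapunov HP HLMI _ => s.
by apply: data_quadratic_matrix_inequality HDelta _ _ (proj1 HTheta) Hres.
Qed.
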